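(* Let $i\ge 0$ be an integer and let $G=(V,E)$ be an $\alpha_i$-metric graph with $m$ edges. There is an algorithm which in total $O(im)$ time outputs, for every vertex $v\in V$, an estimate $\hat e(v)$ of its eccentricity $e(v)$ such that $e(v)-3i-2\le \hat e(v)\le e(v)$.
   Context: All graphs are finite, connected, unweighted, undirected, simple; $d(u,v)$ is the shortest-path distance. $I(u,v)=\{x: d(u,x)+d(x,v)=d(u,v)\}$. A graph is $\alpha_i$-metric if for all vertices $u,v,w,x$: whenever $v\in I(u,w)$, $w\in I(v,x)$ and $v,w$ are adjacent, then $d(u,x)\ge d(u,v)+d(v,x)-i$. The eccentricity of $v$ is $e(v)=\max_u d(u,v)$. *)

(* Defs.v *)
From mathcomp Require Import all_boot.
Set Implicit Arguments. Unset Strict Implicit. Unset Printing Implicit Defensive.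

Section Graph.
Variables (n : nat) (adj : rel 'I_n).

Definition simple_graph : Prop := symmetric adj /\ irreflexive adj.

Fixpoint within (k : nat) (x y : 'I_n) : bool :=
  if k is k'.+1 then within k' x y || [exists z, within k' x z && adj z y]
  else x == y.

Definition connected_graph : Prop := forall x y : 'I_n, exists k, within k x y.

(* shortest-path distance: least k <= n-1 such that within k x y
   (in a connected graph on n vertices such a k always exists) *)
Definition dist (x y : 'I_n) : nat := find (fun k => within k x y) (iota 0 n).

Definition in_interval (u v x : 'I_n) : bool := dist u x + dist x v == dist u v.

(* alpha_i-metric: v in I(u,w), w in I(v,x), v ~ w  ==>
   d(u,x) >= d(u,v) + d(v,x) - i   (stated over nat without subtraction) *)
Definition alpha_metric (i : nat) : Prop :=
  forall u v w x : 'I_n,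
    in_interval u w v -> in_interval v x w -> adj v w ->
    dist u v + dist v x <= dist u x + i.

Definition ecc (v : 'I_n) : nat := \max_(u : 'I_n) dist u v.

Definition num_edges : nat :=
  #|[set p : 'I_n * 'I_n | adj p.1 p.2 && (val p.1 < val p.2)]|.

End Graph.

(*  Cost model: a unit-cost word-RAM-like machine (deep embedding).    *)
Inductive aexp : Type :=
  | AConst of nat
  | AReg of nat
  | ALoad of aexp
  | AAdd of aexp & aexp
  | ASub of aexp & aexp.   (* truncated subtraction *)

Inductive bexp : Type :=
  | BLt of aexp & aexp
  | BEq of aexp & aexp
  | BNot of bexp
  | BAnd of bexp & bexp.

Inductive cmd : Type :=
  | CSkip
  | CSetReg of nat & aexp
  | CStore of aexp & aexp
  | CSeq of cmd & cmd
  | CIf of bexp & cmd & cmd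
  | CWhile of bexp & cmd.

Record mstate := MState { regs : nat -> nat; heap : nat -> nat }.

Fixpoint aeval (s : mstate) (e : aexp) : nat :=
  match e with
  | AConst k => k
  | AReg r => regs s r
  | ALoad e => heap s (aeval s e)
  | AAdd a b => aeval s a + aeval s b
  | ASub a b => aeval s a - aeval s b
  end.

Fixpoint beval (s : mstate) (b : bexp) : bool :=
  match b with
  | BLt a c => aeval s a < aeval s c
  | BEq a c => aeval s a == aeval s c
  | BNot b => ~~ beval s b
  | BAnd b c => beval s b && beval s c
  end.

Definition upd (f : nat -> nat) (a v : nat) : nat -> nat :=
  fun x => if x == a then v else f x.

Inductive exec : cmd -> mstate -> nat -> mstate -> Prop :=
  | ExSkip s : exec CSkip s 1 s
  | ExSetReg s r e :
      exec (CSetReg r e) s 1 (MState (upd (regs s) r (aeval s e)) (heap s))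
  | ExStore s e1 e2 :
      exec (CStore e1 e2) s 1 (MState (regs s) (upd (heap s) (aeval s e1) (aeval s e2)))
  | ExSeq c1 c2 s1 s2 s3 t1 t2 :
      exec c1 s1 t1 s2 -> exec c2 s2 t2 s3 -> exec (CSeq c1 c2) s1 (t1 + t2) s3
  | ExIfT b c1 c2 s s' t :
      beval s b -> exec c1 s t s' -> exec (CIf b c1 c2) s t.+1 s'
  | ExIfF b c1 c2 s s' t :
      ~~ beval s b -> exec c2 s t s' -> exec (CIf b c1 c2) s t.+1 s'
  | ExWhileF b c s : ~~ beval s b -> exec (CWhile b c) s 1 s
  | ExWhileT b c s1 s2 s3 t1 t2 :
      beval s1 b -> exec c s1 t1 s2 -> exec (CWhile b c) s2 t2 s3 ->
      exec (CWhile b c) s1 (t1 + t2).+1 s3.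

(*  Input encoding (adjacency lists, CSR format) in the heap:          *)
(*    heap[0] = n, heap[1] = i, heap[2] = m,                          *)
(*    heap[3+k] = offset of the adjacency list of vertex k (k <= n),   *)
(*    heap[3] = 0, heap[3+n] = 2m, offsets nondecreasing,              *)
(*    the neighbours of k are heap[n+4+j] for off(k) <= j < off(k+1),  *)
(*    listed without repetition in arbitrary order.                    *)
(*  All other heap cells hold arbitrary values.                        *)
Definition adj_off (h : nat -> nat) (k : nat) : nat := h (3 + k).

Definition encodes_graph (n : nat) (adj : rel 'I_n) (i : nat) (h : nat -> nat) : Prop :=
  [/\ h 0 = n, h 1 = i, h 2 = num_edges adj,
      adj_off h 0 = 0 /\ adj_off h n = (num_edges adj).*2 &
      (forall k : 'I_n,
        adj_off h k <= adj_off h k.+1 /\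
        (let L := [seq h (n + 4 + j) | j <- iota (adj_off h k) (adj_off h k.+1 - adj_off h k)] in
         uniq L /\ perm_eq L [seq val y | y <- enum 'I_n & adj k y]))].

Definition init_state (h : nat -> nat) : mstate := MState (fun _ => 0) h.

Definition output (s : mstate) (v : nat) : nat := heap s (regs s 0 + v).

(* Main.v *)
Require Import Defs.
From mathcomp Require Import all_boot zify.

(* Every vertex of a slice [S_k(x, y)] is within [i + 1] of any other one, and one of
   them is at distance at most [max (d v x) (d v y) - min k (d x y - k) + i] from a given
   [v].  If [x] and [y] are mutually distant, routing a shortest path from [v] to a
   farthest vertex through a vertex of the middle slice gives
   [ecc v <= max (d v x) (d v y) + 3 i + 2].  Starting anywhere and moving repeatedly to a
   farthest vertex, the second vertex already has eccentricity at least
   [diam - 4 i - 3], so one of the first [4 i + 6] moves is between mutually distant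
   vertices.  The algorithm runs that many breadth-first searches and returns, for each
   vertex, its largest distance to their sources. *)

Set Implicit Arguments. Unset Strict Implicit. Unset Printing Implicit Defensive.

(** * Eccentricities in alpha_i-metric graphs *)

Section Distance.

Variables (n : nat) (adj : rel 'I_n).
Hypotheses (adj_simple : simple_graph adj) (adj_conn : connected_graph adj).

Local Notation d := (dist adj).

Let adjC : symmetric adj. Proof. by case: adj_simple. Qed.

Lemma within_mono j k x y : j <= k -> within adj j x y -> within adj k x y.
Proof.
elim: k => [|k IHk]; first by rewrite leqn0 => /eqP ->.
rewrite leq_eqVlt => /predU1P[-> //|]; rewrite ltnS => le_jk w_j.
by rewrite /= (IHk le_jk w_j).
Qed.

Lemma within_trans j k x y z :
  within adj j x y -> within adj k y z -> within adj (j + k) x z.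
Proof.
move=> wxy; elim: k z => [|k IHk] z /=; first by move=> /eqP <-; rewrite addn0.
rewrite addnS /= => /orP[/IHk -> //|/existsP[t /andP[/IHk wxt tz]]].
by apply/orP; right; apply/existsP; exists t; rewrite wxt.
Qed.

Lemma within_adj x y : adj x y -> within adj 1 x y.
Proof. by move=> xy /=; apply/orP; right; apply/existsP; exists x; rewrite eqxx. Qed.

Lemma within_sym k x y : within adj k x y -> within adj k y x.
Proof.
elim: k x y => [|k IHk] x y; first by rewrite /= eq_sym.
move=> /= /orP[/IHk -> //|/existsP[t /andP[/IHk wtx ty]]].
by apply: (@within_trans 1 k) wtx; apply: within_adj; rewrite adjC.
Qed.

(* The balls around [x] grow strictly until they stabilise, and a stable ball is
   everything by connectivity. *)
Lemma within_pred_n x y : within adj n.-1 x y.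
Proof.
pose W k := [set z | within adj k x z].
have grow k : k < #|W k| \/ W k = setT.
  elim: k => [|k [IHk|IHk]].
  - by left; apply/card_gt0P; exists x; rewrite inE /=.
  - have sW : W k \subset W k.+1.
      by apply/subsetP => z; rewrite !inE; apply: within_mono.
    have [eW|neW] := eqVneq (W k) (W k.+1); last first.
      by left; apply: leq_ltn_trans IHk _; apply: proper_card; rewrite properEneq neW.
    right; rewrite -eW; apply/setP => z; rewrite !inE.
    have [j] := adj_conn x z; elim: j z => [|j IHj] z.
      by move=> /eqP <-; apply: (@within_mono 0) => //=.
    move=> /= /orP[/IHj //|/existsP[t /andP[/IHj wt tz]]].
    have : z \in W k.+1 by rewrite inE /=; apply/orP; right; apply/existsP; exists t; rewrite wt.
    by rewrite -eW inE.
  - right; apply/setP => z; have : z \in W k by rewrite IHk.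
    by rewrite !inE /= => ->.
case: (grow n.-1) => [big|full]; last first.
  by have : y \in W n.-1; [rewrite full | rewrite inE].
have n_gt0 : 0 < n := leq_ltn_trans (leq0n x) (ltn_ord x).
have /eqP full : W n.-1 == setT.
  by rewrite eqEcard subsetT cardsT card_ord; apply: leq_trans big; rewrite prednK.
by have : y \in W n.-1; [rewrite full | rewrite inE].
Qed.

(** Connectivity keeps [find] from returning its default [n]: by [within_pred_n] some radius below
    [n] works, and monotonicity turns the first one into a threshold. *)
Lemma leq_dist k x y : (d x y <= k) = within adj k x y.
Proof.
have n_gt0 : 0 < n := leq_ltn_trans (leq0n x) (ltn_ord x).
have has_w : has (fun k => within adj k x y) (iota 0 n).
  apply/hasP; exists n.-1; last exact: within_pred_n.
  by rewrite mem_iota add0n leq0n prednK /=.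
have lt_n : d x y < n by rewrite -{2}(size_iota 0 n) -has_find.
have w_d : within adj (d x y) x y.
  by have := nth_find 0 has_w; rewrite nth_iota.
apply/idP/idP => [le_k|w_k]; first exact: within_mono le_k w_d.
rewrite leqNgt; apply/negP => lt_k.
have := before_find 0 lt_k; rewrite nth_iota; last exact: ltn_trans lt_n.
by rewrite add0n w_k.
Qed.

Lemma dist_lt_n x y : d x y < n.
Proof.
have n_gt0 : 0 < n := leq_ltn_trans (leq0n x) (ltn_ord x).
by have := leq_dist n.-1 x y; rewrite within_pred_n -ltnS prednK.
Qed.

Lemma dist_sym x y : d x y = d y x.
Proof. by apply/eqP; rewrite eqn_leq !leq_dist; apply/andP; split; apply: within_sym; rewrite -leq_dist. Qed.

Lemma dist_eq0 x y : (d x y == 0) = (x == y).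
Proof. by rewrite -leqn0 leq_dist. Qed.

Lemma distxx x : d x x = 0.
Proof. by apply/eqP; rewrite dist_eq0. Qed.

Lemma dist_triangle y x z : d x z <= d x y + d y z.
Proof. by rewrite leq_dist; apply: (@within_trans _ _ _ y); rewrite -leq_dist. Qed.

Lemma dist_adj x y : adj x y -> d x y <= 1.
Proof. by rewrite leq_dist; apply: within_adj. Qed.

Lemma dist_adjr x y z : adj y z -> d x z <= (d x y).+1.
Proof. by move=> /dist_adj yz; have := dist_triangle y x z; lia. Qed.

Lemma dist_pred x y : x != y -> exists2 z, adj z y & d x y = (d x z).+1.
Proof.
rewrite -dist_eq0; case E: (d x y) => [//|k] _.
have: within adj k.+1 x y by rewrite -leq_dist E.
rewrite /= -leq_dist E ltnn /= => /existsP[z /andP[wz zy]].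
exists z => //; move: wz; rewrite -leq_dist; have := dist_adjr x zy; lia.
Qed.

Lemma dist_le_ecc x y : d x y <= ecc adj x.
Proof. by rewrite dist_sym /ecc; apply: (@leq_bigmax _ (fun u => d u x) y). Qed.

Lemma eccP k x : reflect (forall y, d x y <= k) (ecc adj x <= k).
Proof.
apply: (iffP idP) => [le_k y|le_k]; first exact: leq_trans (dist_le_ecc x y) le_k.
by apply/bigmax_leqP => y _; rewrite dist_sym.
Qed.

Lemma ecc_attained x : exists y, d x y = ecc adj x.
Proof.
have n_gt0 : 0 < #|'I_n| by rewrite card_ord (leq_ltn_trans (leq0n x)).
have [y] := @eq_bigmax _ (fun u => d u x) n_gt0.
by rewrite dist_sym => e; exists y; rewrite -e.
Qed.

(** * Slices of intervals under the alpha_i condition *)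

Section AlphaMetric.

Variable i : nat.
Hypothesis adj_alpha : alpha_metric adj i.

(** Both interval conditions hold because the edge from [c] to [w] leads exactly one step away from
    [x] and one step closer to [v]. *)
Lemma alpha_step x c w v : adj c w -> d x w = (d x c).+1 -> d c v = (d w v).+1 ->
  d x c + d c v <= d x v + i.
Proof.
move=> cw xw cv; apply: (adj_alpha (w := w)) => //; rewrite /in_interval.
- apply/eqP; have := dist_adjr x cw; have := dist_adj cw; have := dist_triangle c x w; lia.
- apply/eqP; have := dist_adj cw; have := dist_triangle w c v; lia.
Qed.

Lemma slice_vertex x y k : k <= d x y ->
  exists2 c, d x c = k & d c y = d x y - k.
Proof.
elim: k => [|k IHk] lek; first by exists x; rewrite ?distxx ?subn0.
have [c xc cy] := IHk (ltnW lek).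
have neq : y != c by rewrite -dist_eq0 dist_sym; lia.
have [w wc cyw] := dist_pred neq; exists w.
  have := dist_adjr x (etrans (adjC c w) wc); have := dist_triangle w x y.
  rewrite ![d _ y]dist_sym in cy *; rewrite (dist_sym x y) in cy lek *; lia.
by rewrite !(dist_sym _ y) in cy cyw *; lia.
Qed.

(* The vertex of the slice closest to [v] works: the next vertex towards [v] leaves
   the slice, so it moves away from [x] or from [y]. *)
Lemma slice_near x y v k : k <= d x y ->
  exists c, [/\ d x c = k, d c y = d x y - k &
    d v c + minn k (d x y - k) <= maxn (d v x) (d v y) + i].
Proof.
move=> lek; have [c0 xc0 c0y] := slice_vertex lek.
pose S c := (d x c == k) && (d c y == d x y - k).
have Sc0 : S c0 by rewrite /S xc0 c0y !eqxx.
case: (arg_minnP (d v) Sc0) => c /andP[/eqP xc /eqP cy] minc.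
exists c; split=> //.
have [->|neq] := eqVneq v c; first by rewrite distxx (dist_sym c x); lia.
have [w wc vc] := dist_pred neq.
have cw : adj c w by rewrite adjC.
have notS : ~~ S w by apply/negP => /minc; rewrite vc ltnn.
have cv : d c v = (d w v).+1 by rewrite !(dist_sym _ v).
have xw := dist_adjr x cw; have yw := dist_adjr y cw.
have tw := dist_triangle w x y; have tv1 := dist_triangle w c y.
rewrite (dist_sym v x) (dist_sym v y) (dist_sym v c).
have [xw1|nxw] := eqVneq (d x w) (d x c).+1.
  by have := alpha_step cw xw1 cv; lia.
have [yw1|nyw] := eqVneq (d y w) (d y c).+1.
  by have := alpha_step cw yw1 cv; rewrite (dist_sym y c); lia.
move: notS; rewrite /S; rewrite !(dist_sym y) in yw nyw; lia.
Qed.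

(** Induction on the distance to [x]: the neighbours [a] of [c] and [a'] of [c'] one step nearer [x]
    are close to each other. If [c] and [c'] were too far apart, one of the edges [c a], [c' a']
    would violate [alpha_step], depending on how [d c c'] and [d a c'] compare. *)
Lemma slice_thin x y c c' : d x c + d c y = d x y -> d x c' + d c' y = d x y ->
  d x c = d x c' -> d c c' <= i.+1.
Proof.
move E: (d x c) => k; elim: k c c' E => [|k IHk] c c' xc.
  move=> _ _ /esym/eqP; rewrite dist_eq0 => /eqP <-.
  by move/eqP: xc; rewrite dist_eq0 => /eqP <-; rewrite distxx.
move=> cy c'y xc'; rewrite leqNgt; apply/negP => big.
have neq : x != c by rewrite -dist_eq0 xc.
have neq' : x != c' by rewrite -dist_eq0 -xc'.
have [a ac xa] := dist_pred neq; have [a' ac' xa'] := dist_pred neq'.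
have ca : adj c a by rewrite adjC.
have ca' : adj c' a' by rewrite adjC.
have ya : d y a = (d y c).+1.
  by have := dist_adjr y ca; have := dist_triangle a x y; rewrite !(dist_sym y); lia.
have ya' : d y a' = (d y c').+1.
  by have := dist_adjr y ca'; have := dist_triangle a' x y; rewrite !(dist_sym y); lia.
have ay : d a y = (d c y).+1 by rewrite !(dist_sym _ y).
have ay' : d a' y = (d c' y).+1 by rewrite !(dist_sym _ y).
have thin : d a a' <= i.+1 by apply: IHk; lia.
have le1 := dist_adjr c' ca; have le2 := dist_adjr c' ac.
have le3 := dist_adjr a ca'; have le4 := dist_adjr a ac'.
rewrite !(dist_sym c') in le1 le2.
(* The edge [c a] leaves [c'] and approaches [x]; as [c] and [c'] are equally far from [x], this
   gives [d c c' <= i]. *)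
have [up|nup] := eqVneq (d a c') (d c c').+1.
  have := alpha_step (x := c') (v := x) ca.
  by rewrite !(dist_sym c') !(dist_sym _ x); lia.
(* Now [c a] leaves [y] and approaches [c'], with [c] and [c'] equally far from [y]. *)
have [down|ndown] := eqVneq (d c c') (d a c').+1.
  by have := alpha_step ca ya down; rewrite !(dist_sym y); lia.
(* Otherwise [d a c' = d c c'] exceeds [i.+1], hence also [d a a'], so [c' a'] approaches [a] while
   leaving [y]. As [a] is one step further from [y] than [c'], this gives [d a c' <= i.+1]. *)
have aa' : d c' a = (d a' a).+1 by rewrite !(dist_sym _ a); lia.
by have := alpha_step ca' ya' aa'; rewrite (dist_sym c' a) !(dist_sym y); lia.
Qed.

(** Passing from the vertex of [slice_near] to an arbitrary one of the same slice costs [i.+1] by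
    [slice_thin], on top of the [i] already lost. *)
Lemma dist_interval x y v z : d x z + d z y = d x y ->
  d v z + minn (d x z) (d z y) <= maxn (d v x) (d v y) + (2 * i).+1.
Proof.
move=> xzy.
have [|c [xc cy vc]] := @slice_near x y v (d x z); first lia.
have thin : d c z <= i.+1 by apply: (@slice_thin x y); lia.
have := dist_triangle c v z; lia.
Qed.

(** The leg from [v] to the middle vertex [c] loses [i], the leg from [c] to [z] loses [2 * i + 1],
    and the last unit pays for an odd [d x y]. Mutual distance bounds [d z x] and [d z y] by
    [d x y], which the two halves cancel. *)
Lemma ecc_mutually_distant x y v : d x y = ecc adj x -> d x y = ecc adj y ->
  ecc adj v <= maxn (d x v) (d y v) + (3 * i + 2).
Proof.
move=> ex ey; apply/eccP => z.
have [|c [xc cy vc]] := @slice_near x y v (d x y)./2; first lia.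
have zc : d z c + minn (d x c) (d c y) <= maxn (d z x) (d z y) + (2 * i).+1.
  by apply: dist_interval; lia.
have zx : d z x <= d x y by rewrite ex dist_sym dist_le_ecc.
have zy : d z y <= d x y by rewrite ey dist_sym dist_le_ecc.
have := dist_triangle c v z; rewrite (dist_sym c z) !(dist_sym _ v); lia.
Qed.

(** With [c] midway between [a] and [b], each of [d u c] and [d x c] is at most the eccentricity of
    [u], respectively [x], plus [2 * i + 1] minus half of [d a b]. In [d u x <= d u c + d c x] the
    term [ecc adj u] cancels; rounding costs one more. *)
Lemma ecc_far u x a b : d u x = ecc adj u -> d a b <= ecc adj x + (4 * i + 3).
Proof.
move=> ux.
have [|c ac cb] := @slice_vertex a b (d a b)./2; first lia.
have uc : d u c + minn (d a c) (d c b) <= maxn (d u a) (d u b) + (2 * i).+1.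
  by apply: dist_interval; lia.
have xc : d x c + minn (d a c) (d c b) <= maxn (d x a) (d x b) + (2 * i).+1.
  by apply: dist_interval; lia.
have := dist_le_ecc u a; have := dist_le_ecc u b.
have := dist_le_ecc x a; have := dist_le_ecc x b.
have := dist_triangle c u x; rewrite (dist_sym c x); lia.
Qed.

(** * Sweeps through successive farthest vertices *)

Definition farthest : rel 'I_n := fun x y => d x y == ecc adj x.

(* Eccentricities are nondecreasing along the sweep; past the second vertex they are
   within [4 i + 3] of the diameter, so two consecutive ones coincide. *)
Lemma ecc_sweep xs v : sorted farthest xs -> size xs = 4 * i + 6 ->
  ecc adj v <= \max_(x <- xs) d x v + (3 * i + 2).
Proof.
move=> /(sortedP v) far_xs size_xs; pose x j := nth v xs j.
have far j : j < 4 * i + 5 -> d (x j) (x j.+1) = ecc adj (x j).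
  by move=> lt_j; apply/eqP/far_xs; lia.
have mono j : j < 4 * i + 5 -> ecc adj (x j) <= ecc adj (x j.+1).
  by move=> lt_j; rewrite -(far j lt_j) dist_sym dist_le_ecc.
case: (boolP [exists j : 'I_(4 * i + 5), ecc adj (x j) == ecc adj (x j.+1)]).
  case/existsP => -[j lt_j] /= /eqP eq_ecc.
  have in_max k : k < size xs -> d (x k) v <= \max_(z <- xs) d z v.
    by move=> lt_k; apply: (@leq_bigmax_seq _ xs predT (fun z => d z v)) => //; rewrite mem_nth.
  have := @ecc_mutually_distant (x j) (x j.+1) v (far j lt_j) (etrans (far j lt_j) eq_ecc).
  have := in_max j; have := in_max j.+1; lia.
move=> /existsPn neq_ecc.
have grow k : k <= 4 * i + 4 -> ecc adj (x 1) + k <= ecc adj (x k.+1).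
  elim: k => [|k IHk] le_k; first by rewrite addn0.
  have lt_k : k.+1 < 4 * i + 5 by lia.
  have := neq_ecc (Ordinal lt_k) => /=; have := mono _ lt_k; have := IHk (ltnW le_k); lia.
have [y exy] := ecc_attained (x (4 * i + 5)).
have x01 : d (x 0) (x 1) = ecc adj (x 0) by apply: far; lia.
have := ecc_far (x (4 * i + 5)) y x01; have := grow (4 * i + 4) (leqnn _).
rewrite exy -addnS; lia.
Qed.

End AlphaMetric.

(** * Breadth-first search *)

Section BreadthFirst.

Variable s : 'I_n.

(* [q] is the sequence of vertices enqueued so far, of which the first [k] have been
   fully scanned; [P] holds of the neighbours of the next one scanned so far. *)
Record bfs_inv (q : seq 'I_n) (k : nat) (P : 'I_n -> Prop) : Prop := BfsInv {
  bfs_uniq : uniq q;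
  bfs_source : s \in q;
  bfs_sorted : forall a b, a <= b -> b < size q -> d s (nth s q a) <= d s (nth s q b);
  bfs_window : k < size q -> forall x, x \in q -> d s x <= (d s (nth s q k)).+1;
  bfs_closed : forall j z, j < k -> j < size q -> adj (nth s q j) z -> z \in q;
  bfs_partial : forall z, P z -> z \in q }.

Lemma bfs_inv0 P : (forall z, ~ P z) -> bfs_inv [:: s] 0 P.
Proof.
move=> noP; split=> //.
- by rewrite inE.
- by move=> [|a] [|b].
- by move=> _ x; rewrite inE => /eqP ->; rewrite distxx.
- by move=> z /noP.
Qed.

Lemma bfs_inv_ext q k P P' : (forall z, P' z -> P z \/ z \in q) ->
  bfs_inv q k P -> bfs_inv q k P'.
Proof. by move=> P'P [? ? ? ? ? Pq]; split=> // z /P'P[/Pq|]. Qed.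

(** Induction on the distance: the predecessor [y] of [z] on a shortest path is queued and strictly
    closer to [s] than the head, so by sortedness it precedes the head, has been scanned, and caused
    [z] to be queued. *)
Lemma bfs_ball q k P : bfs_inv q k P -> k < size q ->
  forall z, d s z <= d s (nth s q k) -> z \in q.
Proof.
move=> inv lt_k z; move: {2}(d s z) (leqnn (d s z)) => r.
elim: r z => [|r IHr] z le_r le_k.
  by move: le_r; rewrite leqn0 dist_eq0 => /eqP <-; apply: bfs_source inv.
have [<-|neq] := eqVneq s z; first exact: bfs_source inv.
have [y yz sz] := dist_pred neq.
have /(nthP s)[j lt_j yj] : y \in q by apply: IHr; lia.
apply: (bfs_closed inv (j := j)) => //; last by rewrite yj.
rewrite ltnNge; apply/negP => /(bfs_sorted inv) /(_ lt_j); rewrite yj; lia.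
Qed.

Lemma bfs_dist_new q k P w : bfs_inv q k P -> k < size q ->
  adj (nth s q k) w -> w \notin q -> d s w = (d s (nth s q k)).+1.
Proof.
move=> inv lt_k aw notw; apply/eqP; rewrite eqn_leq dist_adjr //= ltnNge.
by apply: contra notw => /(bfs_ball inv lt_k).
Qed.

(** Appending keeps the queue sorted: the new vertex is one step beyond the head, the largest
    distance that [bfs_window] allows. *)
Lemma bfs_inv_push q k P w : bfs_inv q k P -> k < size q ->
  adj (nth s q k) w -> w \notin q -> bfs_inv (rcons q w) k P.
Proof.
move=> inv lt_k aw notw; have dw := bfs_dist_new inv lt_k aw notw.
have in_rcons z : z \in q -> z \in rcons q w by rewrite mem_rcons inE orbC => ->.
case: inv => q_uniq q_s q_sorted q_window q_closed q_P.
split=> //; rewrite ?size_rcons.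
- by rewrite rcons_uniq notw.
- exact: in_rcons.
- move=> a b le_ab lt_b; rewrite !nth_rcons.
  have [lt_b'|ge_b] := ltnP b (size q); first by rewrite (leq_ltn_trans le_ab lt_b') q_sorted.
  have -> : b == size q by lia.
  have [lt_a|ge_a] := ltnP a (size q); first by rewrite dw q_window ?mem_nth.
  by have -> : a == size q by lia.
- move=> _ x; rewrite mem_rcons inE nth_rcons lt_k => /predU1P[->|/q_window-> //].
  by rewrite dw.
- move=> j z lt_j _; rewrite nth_rcons (ltn_trans lt_j lt_k) => az.
  by apply/in_rcons/(q_closed j) => //; apply: ltn_trans lt_k.
- by move=> z /q_P/in_rcons.
Qed.

Lemma bfs_inv_next q k P P' : bfs_inv q k P -> (forall z, adj (nth s q k) z -> P z) ->
  (forall z, ~ P' z) -> bfs_inv q k.+1 P'.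
Proof.
case=> q_uniq q_s q_sorted q_window q_closed q_P allP noP'; split=> //.
- move=> lt_k x /q_window le_x; apply: leq_trans (le_x (ltnW lt_k)) _.
  by rewrite ltnS q_sorted.
- move=> j z; rewrite ltnS leq_eqVlt => /predU1P[->|lt_j] lt_jq; last exact: q_closed.
  by move=> /allP/q_P.
- by move=> z /noP'.
Qed.

Lemma bfs_inv_all q k P : bfs_inv q k P -> size q <= k -> forall z, z \in q.
Proof.
move=> inv le_k z; have [r w_r] := adj_conn s z.
elim: r z w_r => [|r IHr] z; first by move=> /eqP <-; apply: bfs_source inv.
move=> /= /orP[/IHr //|/existsP[y /andP[/IHr /(nthP s)[j lt_j yj] yz]]].
by apply: (bfs_closed inv (j := j)); rewrite ?yj // (leq_trans lt_j).
Qed.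

Lemma bfs_last_farthest q k P : bfs_inv q k P -> size q <= k ->
  farthest s (nth s q (size q).-1).
Proof.
move=> inv le_k; rewrite /farthest eqn_leq dist_le_ecc /=; apply/eccP => z.
have /(nthP s)[j lt_j <-] := bfs_inv_all inv le_k z.
have lt_0 := leq_ltn_trans (leq0n j) lt_j.
by apply: (bfs_sorted inv); rewrite ?prednK // -ltnS prednK.
Qed.

Lemma bfs_size q k P : bfs_inv q k P -> size q <= n.
Proof. by move=> /bfs_uniq/card_uniqP <-; rewrite -[X in _ <= X]card_ord max_card. Qed.

End BreadthFirst.

End Distance.

(** * The program *)

(** Total correctness with cost: termination is part of the claim, and the postcondition sees the
    running time. *)
Definition runs (c : cmd) (s : mstate) (Q : nat -> mstate -> Prop) : Prop :=
  exists t s', exec c s t s' /\ Q t s'.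

Lemma runs_skip s Q : Q 1 s -> runs CSkip s Q.
Proof. by exists 1, s; split=> //; constructor. Qed.

Lemma runs_set r e s Q :
  Q 1 (MState (upd (regs s) r (aeval s e)) (heap s)) -> runs (CSetReg r e) s Q.
Proof. by eexists _, _; split; first exact: ExSetReg. Qed.

Lemma runs_store e1 e2 s Q :
  Q 1 (MState (regs s) (upd (heap s) (aeval s e1) (aeval s e2))) ->
  runs (CStore e1 e2) s Q.
Proof. by eexists _, _; split; first exact: ExStore. Qed.

Lemma runs_seq c1 c2 s Q :
  runs c1 s (fun t1 s1 => runs c2 s1 (fun t2 => Q (t1 + t2))) -> runs (CSeq c1 c2) s Q.
Proof.
move=> [t1 [s1 [ex1 [t2 [s2 [ex2 q]]]]]].
by exists (t1 + t2), s2; split=> //; apply: ExSeq ex1 ex2.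
Qed.

Lemma runs_if b c1 c2 s Q :
  (if beval s b then runs c1 s (fun t => Q t.+1) else runs c2 s (fun t => Q t.+1)) ->
  runs (CIf b c1 c2) s Q.
Proof.
case: ifPn => sb [t [s' [ex q]]]; exists t.+1, s'; split=> //.
  exact: ExIfT.
exact: ExIfF.
Qed.

Lemma runs_mono c s (Q Q' : nat -> mstate -> Prop) :
  (forall t s', Q t s' -> Q' t s') -> runs c s Q -> runs c s Q'.
Proof. by move=> QQ' [t [s' [ex /QQ' q]]]; exists t, s'. Qed.

(* [I j] says that at most [j] iterations remain, each taking time at most [T]. *)
Lemma runs_while b c T (I : nat -> mstate -> Prop) j s Q :
  (forall j s, I j s -> beval s b ->
     runs c s (fun t s' => t <= T /\ exists2 j', j' < j & I j' s')) ->
  I j s ->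
  (forall j' t s', I j' s' -> ~~ beval s' b -> t <= (j * T.+1).+1 -> Q t s') ->
  runs (CWhile b c) s Q.
Proof.
move=> body; elim/ltn_ind: j s Q => j IHj s Q Ijs post.
case: (boolP (beval s b)) => sb; last first.
  by exists 1, s; split; [exact: ExWhileF | exact: post Ijs sb _].
have [t1 [s1 [ex1 [le_t1 [j' lt_j' Is1]]]]] := body _ _ Ijs sb.
have [|t2 [s2 [ex2 q]]] := IHj j' lt_j' s1 (fun t => Q (t1 + t).+1) Is1.
  by move=> j2 t2 s2 Is2 sb2 le_t2; apply: post Is2 sb2 _; nia.
by exists (t1 + t2).+1, s2; split=> //; apply: ExWhileT ex1 ex2.
Qed.

Local Notation "c1 ;; c2" := (CSeq c1 c2) (at level 60, right associativity).

(** Register numbers. [Est] is register 0 because [output] takes the base address of the results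
    from there. *)
Local Notation Est := 0 (only parsing).
Local Notation Size := 1 (only parsing).
Local Notation Dist := 2 (only parsing).
Local Notation Queue := 3 (only parsing).
Local Notation Round := 4 (only parsing).
Local Notation Cur := 5 (only parsing).
Local Notation Vertex := 6 (only parsing).
Local Notation Head := 7 (only parsing).
Local Notation Tail := 8 (only parsing).
Local Notation Ptr := 9 (only parsing).
Local Notation Nbr := 10 (only parsing).

Local Notation at_ b e := (AAdd (AReg b) e) (only parsing).

Definition incr r : cmd := CSetReg r (AAdd (AReg r) (AConst 1)).

Definition fill (b : nat) (e : aexp) : cmd :=
  CSetReg Vertex (AConst 0) ;;
  CWhile (BLt (AReg Vertex) (AReg Size))
    (CStore (at_ b (AReg Vertex)) e ;; incr Vertex).

(** [Round] becomes [4 * i + 6], the sweep length of [ecc_sweep], by additions only as the machine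
    has no multiplication. [Cur] keeps its initial 0, so vertex 0 is the first source. *)
Definition setup : cmd :=
  CSetReg Size (ALoad (AConst 0)) ;;
  CSetReg Est (AAdd (AAdd (AReg Size) (AConst 4))
                    (AAdd (ALoad (AConst 2)) (ALoad (AConst 2)))) ;;
  CSetReg Dist (AAdd (AReg Est) (AReg Size)) ;;
  CSetReg Queue (AAdd (AReg Dist) (AReg Size)) ;;
  CSetReg Round (AAdd (AAdd (AAdd (ALoad (AConst 1)) (ALoad (AConst 1)))
                            (AAdd (ALoad (AConst 1)) (ALoad (AConst 1)))) (AConst 6)) ;;
  fill Est (AConst 0).

(** All distances are below [n], so the value [n] can mark unreached vertices. *)
Definition bfs_start : cmd :=
  fill Dist (AReg Size) ;;
  CStore (at_ Dist (AReg Cur)) (AConst 0) ;;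
  CStore (AReg Queue) (AReg Cur) ;;
  CSetReg Head (AConst 0) ;;
  CSetReg Tail (AConst 1) ;;
  CSetReg Ptr (ALoad (AAdd (AConst 3) (AReg Cur))).

(* The two nested loops of breadth-first search are merged into one: an iteration either
   scans one neighbour of the head of the queue or dequeues it. *)
Definition bfs_step : cmd :=
  CSetReg Cur (ALoad (at_ Queue (AReg Head))) ;;
  CIf (BLt (AReg Ptr) (ALoad (AAdd (AConst 4) (AReg Cur))))
    (CSetReg Nbr (ALoad (AAdd (AAdd (AReg Size) (AConst 4)) (AReg Ptr))) ;;
     CIf (BEq (ALoad (at_ Dist (AReg Nbr))) (AReg Size))
       (CStore (at_ Dist (AReg Nbr)) (AAdd (ALoad (at_ Dist (AReg Cur))) (AConst 1)) ;;
        CStore (at_ Queue (AReg Tail)) (AReg Nbr) ;;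
        incr Tail)
       CSkip ;;
     incr Ptr)
    (incr Head ;;
     CSetReg Ptr (ALoad (AAdd (AConst 3) (ALoad (at_ Queue (AReg Head)))))).

Definition bfs_loop : cmd := CWhile (BLt (AReg Head) (AReg Tail)) bfs_step.

(* With truncated subtraction [x + (y - x)] is the maximum of [x] and [y]. *)
Definition merge_dist : cmd :=
  fill Est (AAdd (ALoad (at_ Est (AReg Vertex)))
                 (ASub (ALoad (at_ Dist (AReg Vertex))) (ALoad (at_ Est (AReg Vertex))))).

(* At the end of [bfs_loop], [Cur] holds the last vertex dequeued, which is farthest
   from the source and serves as the next source. *)
Definition sweep : cmd :=
  CWhile (BLt (AConst 0) (AReg Round))
    (CSetReg Round (ASub (AReg Round) (AConst 1)) ;; bfs_start ;; bfs_loop ;; merge_dist).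

Definition ecc_program : cmd := setup ;; sweep.

(** The value [f v] is required only in states where the array cells from [v] on are untouched, so
    [e] may read the cell about to be overwritten, as in [merge_dist]. An iteration costs 3 with its
    test; initialisation and the exit test add 2. *)
Lemma runs_fill b e (f : nat -> nat) s Q : b != Vertex ->
  (forall v s', v < regs s Size -> (forall r, r != Vertex -> regs s' r = regs s r) ->
     regs s' Vertex = v ->
     (forall a, ~~ (regs s b <= a < regs s b + v) -> heap s' a = heap s a) ->
     aeval s' e = f v) ->
  (forall t s', t <= 3 * regs s Size + 2 -> (forall r, r != Vertex -> regs s' r = regs s r) ->
     (forall v, v < regs s Size -> heap s' (regs s b + v) = f v) ->
     (forall a, ~~ (regs s b <= a < regs s b + regs s Size) -> heap s' a = heap s a) ->
     Q t s') ->
  runs (fill b e) s Q.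
Proof.
move=> neq_b val_e post; apply: runs_seq; apply: runs_set.
set N := regs s Size in val_e post; set B := regs s b in val_e post.
pose I j s' := exists2 v, v + j = N &
  [/\ forall r, r != Vertex -> regs s' r = regs s r, regs s' Vertex = v,
      forall w, w < v -> heap s' (B + w) = f w &
      forall a, ~~ (B <= a < B + v) -> heap s' a = heap s a].
apply: (@runs_while _ _ 2 I N) => [j s1 [v vj [s1r s1v s1f s1h]] /=| |j' t s1].
- rewrite s1v s1r // => lt_v; apply: runs_seq; apply: runs_store; apply: runs_set.
  split=> //; exists j.-1; first by move: vj lt_v; rewrite -/N; lia.
  exists v.+1; first by move: vj lt_v; rewrite -/N; lia.
  have ve : aeval s1 e = f v by apply: val_e.
  split=> /=.
  + by move=> r /negbTE r6; rewrite /upd r6 s1r ?r6.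
  + by rewrite /upd /= s1v addn1.
  + move=> w lt_w; rewrite s1v s1r // -/B /upd eqn_add2l.
    by have [->|neq_w] := eqVneq w v; [exact: ve | apply: s1f; lia].
  + by move=> a na; rewrite s1v s1r // -/B /upd; case: eqP => [|_]; [|apply: s1h]; lia.
- by exists 0 => //; split=> //= r /negbTE r6; rewrite /upd r6.
- case=> v vj [s1r s1v s1f s1h] /=; rewrite s1v s1r // -/N => le_v le_t.
  have vN : v = N by lia.
  by apply: post => //; rewrite -?vN //; lia.
Qed.

(** * Correctness and running time *)

Section Correctness.

Variables (n : nat) (adj : rel 'I_n) (i : nat) (h : nat -> nat).
Hypotheses (adj_simple : simple_graph adj) (adj_conn : connected_graph adj).
Hypothesis h_enc : encodes_graph adj i h.

Local Notation d := (dist adj).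
Local Notation m := (num_edges adj).
Local Notation off := (adj_off h).

Definition deg (k : nat) : nat := off k.+1 - off k.

Lemma off_nondecreasing j k : j <= k <= n -> off j <= off k.
Proof.
case: h_enc => _ _ _ _ offP /andP[]; elim: k => [|k IHk]; first by rewrite leqn0 => /eqP ->.
rewrite leq_eqVlt => /predU1P[-> //|le_jk] lt_k.
exact: leq_trans (IHk le_jk (ltnW lt_k)) (offP (Ordinal lt_k)).1.
Qed.

Lemma off_le k : k <= n -> off k <= m.*2.
Proof. by case: h_enc => _ _ _ [_ <-] _ le_k; apply: off_nondecreasing; rewrite le_k /=. Qed.

Lemma nbr_adj (k : 'I_n) p : off k <= p < off k.+1 ->
  exists2 w : 'I_n, h (n + 4 + p) = w & adj k w.
Proof.
case: h_enc => _ _ _ _ /(_ k)[_ [_ /perm_mem eqL]] range_p.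
have: h (n + 4 + p) \in [seq val y | y <- enum 'I_n & adj k y].
  by rewrite -eqL; apply/mapP; exists p => //; rewrite mem_iota; lia.
by case/mapP => w; rewrite mem_filter => /andP[kw _] e; exists w.
Qed.

Lemma adj_nbr (k w : 'I_n) : adj k w ->
  exists2 p, off k <= p < off k.+1 & h (n + 4 + p) = w.
Proof.
case: h_enc => _ _ _ _ /(_ k)[_ [_ /perm_mem eqL]] kw.
have: val w \in [seq val y | y <- enum 'I_n & adj k y].
  by apply: map_f; rewrite mem_filter kw mem_enum.
by rewrite -eqL => /mapP[p]; rewrite mem_iota => range_p e; exists p => //; lia.
Qed.

Lemma sum_deg : \sum_(k < n) deg k = m.*2.
Proof.
case: h_enc => _ _ _ [off0 offn] _.
rewrite -(big_mkord xpredT deg) telescope_sumn_in ?off0 ?offn ?subn0 //.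
by move=> k /andP[_ lt_k]; apply: off_nondecreasing; rewrite leqnSn.
Qed.

(** Absorbs costs linear in [n] into the bound in [m]. With two or more vertices, connectivity gives
    each a neighbour, so the degree sum is at least [n]; the [+ 1] covers the one-vertex graph. *)
Lemma leq_size_edges : n <= m.*2 + 1.
Proof.
have [le1|gt1] := leqP n 1; first lia.
suff : \sum_(k < n) 1 <= \sum_(k < n) deg k.
  by rewrite sum_deg sum1_card card_ord; lia.
apply: leq_sum => k _.
have [y neq] : exists y : 'I_n, y != k.
  have lt1 := ltnW gt1; have [k0|] := eqVneq (val k) 0.
    by exists (Ordinal gt1); rewrite -val_eqE /= k0.
  by exists (Ordinal lt1); rewrite -val_eqE /= eq_sym.
have [z zk _] := dist_pred adj_conn neq.
have [p range_p _] : exists2 p, off k <= p < off k.+1 & h (n + 4 + p) = z.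
  by apply: adj_nbr; rewrite adj_simple.1.
by rewrite /deg; lia.
Qed.

(** Potential of the search: taken at the dequeued prefix of the queue, it bounds the neighbour
    scans still to come. *)
Definition unscanned (q : seq 'I_n) : nat := \sum_(x : 'I_n | x \notin q) deg x.

Lemma unscanned_nil : unscanned [::] = m.*2.
Proof. by rewrite -sum_deg; apply: eq_bigl. Qed.

Lemma unscanned_next (x0 : 'I_n) (q : seq 'I_n) k : uniq q -> k < size q ->
  unscanned (take k q) = deg (nth x0 q k) + unscanned (take k.+1 q).
Proof.
move=> q_uniq lt_k; have notin : nth x0 q k \notin take k q.
  have := take_uniq k.+1 q_uniq.
  by rewrite (take_nth x0 lt_k) rcons_uniq => /andP[].
rewrite /unscanned (bigD1 (nth x0 q k) notin) /=; congr addn; apply: eq_bigl => y.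
by rewrite (take_nth x0 lt_k) mem_rcons inE negb_or andbC.
Qed.

(* First address after the input; the three arrays of length [n] start there. *)
Definition est_addr : nat := n + 4 + m.*2.

Record layout (s : mstate) (c : nat) (e : 'I_n -> nat) : Prop := Layout {
  reg_est : regs s Est = est_addr;
  reg_size : regs s Size = n;
  reg_dist : regs s Dist = est_addr + n;
  reg_queue : regs s Queue = est_addr + n + n;
  reg_round : regs s Round = c;
  heap_input : forall a, a < est_addr -> heap s a = h a;
  heap_est : forall v : 'I_n, heap s (est_addr + v) = e v }.

Lemma runs_setup s Q : heap s = h -> regs s Cur = 0 ->
  (forall t s', t <= 3 * n + 10 -> layout s' (4 * i + 6) (fun=> 0) -> regs s' Cur = 0 -> Q t s') ->
  runs setup s Q.
Proof.
case: s => R H /= -> R5 post; case: h_enc => h0 h1 h2 _ _.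
do 5! (apply: runs_seq; apply: runs_set).
rewrite /upd /= h0 h1 h2.
apply: (@runs_fill _ _ (fun=> 0)) => //= t s' le_t s'r s'e s'h.
apply: post; [lia| |by rewrite s'r].
split; rewrite ?s'r //; rewrite /= /est_addr; try lia.
- by move=> a lt_a; apply: s'h; lia.
- by move=> v; apply: etrans (s'e v (ltn_ord v)); congr (heap s' _); rewrite /=; lia.
Qed.

(** * A single breadth-first search on the machine *)

Section Source.

Variable src : 'I_n.

(* [j] counts the remaining iterations: one per vertex not yet dequeued and one per entry
   not yet scanned of their adjacency lists.  When the queue is empty, [Ptr] is junk. *)
Record bfs_state (j : nat) (c : nat) (e : 'I_n -> nat) (q : seq 'I_n) (s : mstate) : Prop :=
  BfsState {
  bs_layout : layout s c e;
  bs_inv : bfs_inv adj src q (regs s Head) (fun z => regs s Head < size q /\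
      exists2 p, off (nth src q (regs s Head)) <= p < regs s Ptr & h (n + 4 + p) = z);
  bs_tail : regs s Tail = size q;
  bs_head : regs s Head <= size q;
  bs_queue : forall a, a < size q -> heap s (est_addr + n + n + a) = nth src q a;
  bs_dist : forall v : 'I_n,
    heap s (est_addr + n + v) = if v \in q then d src v else n;
  bs_ptr : regs s Head < size q ->
    off (nth src q (regs s Head)) <= regs s Ptr <= off (nth src q (regs s Head)).+1;
  bs_cur : regs s Head = size q -> regs s Cur = nth src q (size q).-1;
  bs_todo : j + (if regs s Head < size q then regs s Ptr - off (nth src q (regs s Head)) else 0)
    = n - regs s Head + unscanned (take (regs s Head) q) }.

Lemma runs_bfs_start s c e Q : layout s c e -> regs s Cur = src ->
  (forall t s', t <= 3 * n + 7 -> bfs_state (n + m.*2) c e [:: src] s' -> Q t s') ->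
  runs bfs_start s Q.
Proof.
move=> L s5 post; apply: runs_seq.
apply: (@runs_fill _ _ (fun=> n)) => // [v s' _ s'r _ _|t s1 le_t s1r s1d s1h].
  by rewrite /= s'r // (reg_size L).
do 2! (apply: runs_seq; apply: runs_store).
do 2! (apply: runs_seq; apply: runs_set).
apply: runs_set; rewrite /=.
rewrite (reg_size L) (reg_dist L) in s1d s1h le_t.
have lt_src := ltn_ord src; have le_off := off_le (ltnW lt_src).
have eh k : k <= n -> heap s1 (3 + k) = off k.
  by move=> le_k; rewrite s1h ?(heap_input L) // /est_addr; lia.
rewrite /upd /= !s1r // s5 (reg_dist L) (reg_queue L).
apply: post; first lia.
(* The two stores fall beyond the input, so the offset of [src] is read unchanged. *)
have Ptr0 : (if 3 + src == est_addr + n + n then val src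
             else if 3 + src == est_addr + n + src then 0 else heap s1 (3 + src)) = off src.
  by rewrite !ifN ?eh //; rewrite /est_addr; lia.
split=> //=; rewrite ?Ptr0.
- split; rewrite /= ?s1r //.
  + exact: reg_est L.
  + exact: reg_size L.
  + exact: reg_dist L.
  + exact: reg_queue L.
  + exact: reg_round L.
  + by move=> a lt_a; rewrite !ifN ?s1h ?(heap_input L) //; lia.
  + by move=> v; have lt_v := ltn_ord v; rewrite !ifN ?s1h ?(heap_est L) //; lia.
- by apply: bfs_inv0 => // z [_ [p]]; lia.
- by move=> [|//] _; rewrite addn0 eqxx.
- move=> v; have lt_v := ltn_ord v; rewrite inE ifN; last lia.
  rewrite eqn_add2l val_eqE; have [->|_] := eqVneq v src; first by rewrite distxx.
  exact: s1d.
- by move=> _; rewrite leqnn off_nondecreasing // leqnSn.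
- by rewrite subnn addn0 subn0 unscanned_nil.
Qed.

(** A scan advances [Ptr] and a dequeue advances [Head], so every branch lowers the count by one.
    The bound 8 is the cost of enqueueing a new neighbour, the longest branch. *)
Lemma runs_bfs_step j c e q s : bfs_state j c e q s -> regs s Head < regs s Tail ->
  runs bfs_step s (fun t s' => t <= 8 /\
    exists2 j', j' < j & exists q', bfs_state j' c e q' s').
Proof.
case=> L inv tail le_k qh dh ptr _ todo; rewrite tail => lt_k.
have k_n : regs s Head < n := leq_trans lt_k (bfs_size inv).
have q_uniq := bfs_uniq inv.
have todo_k := unscanned_next src q_uniq lt_k.
move: todo (ptr lt_k); rewrite lt_k todo_k => {ptr}.
set k := regs s Head in inv le_k lt_k k_n todo_k *; set p := regs s Ptr in inv *.
set u := nth src q k in inv todo_k * => todo /andP[ge_p le_p].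
have lt_u := ltn_ord u; have le_off := off_le lt_u.
have read_off v : v <= n -> heap s (3 + v) = off v.
  by move=> le_v; rewrite (heap_input L) // /est_addr; lia.
apply: runs_seq; apply: runs_set; apply: runs_if.
(* Cell [4 + u] holds the offset of vertex number [u.+1], which is the end of the list of [u]. *)
rewrite /upd /= (reg_queue L) -/k qh // -/u -/p -[4 + u]/(3 + u.+1) read_off //.
case: ltnP => [lt_p|ge_off].
  have [|w hw uw] := @nbr_adj u p; first by rewrite ge_p.
  have lt_w := ltn_ord w.
  apply: runs_seq; apply: runs_set; apply: runs_seq; apply: runs_if.
  have read_w : heap s (n + 4 + p) = w by rewrite (heap_input L) // /est_addr; lia.
  rewrite /upd /= (reg_size L) -/p read_w (reg_dist L) dh.
  have notin_n : (if w \in q then d src w else n) == n = (w \notin q).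
    by case: ifP => _; [exact: ltn_eqF (dist_lt_n adj_conn _ _) | exact: eqxx].
  rewrite notin_n; have [w_q|w_q] /= := boolP (w \in q).
    apply: runs_skip; apply: runs_set; rewrite /upd /=; split=> //.
    exists j.-1; first by move: todo; rewrite /deg; lia.
    exists q; split; rewrite //= -/k -/p ?lt_k -?/u.
    - by split; case: L.
    - apply: bfs_inv_ext inv => z [_ [p' range_p' hz]].
      have [eq_p|ne_p] := eqVneq p' p.
        by right; have -> : z = w by apply: val_inj; rewrite /= -hz -hw eq_p.
      by left; split=> //; exists p' => //; lia.
    - by lia.
    - by move: lt_k => /[swap] ->; rewrite ltnn.
    - by rewrite todo_k; move: todo; rewrite /deg; lia.
  do 2! (apply: runs_seq; apply: runs_store); do 2! apply: runs_set.
  have u_q : u \in q by rewrite mem_nth.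
  have w_dist := bfs_dist_new adj_conn inv lt_k uw w_q.
  have push := bfs_inv_push adj_conn inv lt_k uw w_q.
  have size_n := bfs_size push; rewrite size_rcons in size_n.
  rewrite /upd /= (reg_dist L) (reg_queue L) tail dh u_q; split=> //.
  exists j.-1; first by move: todo; rewrite /deg; lia.
  (* Enqueueing leaves the dequeued prefix alone, hence also the potential. *)
  have take_k : take k (rcons q w) = take k q by rewrite -cats1 takel_cat.
  exists (rcons q w); split; rewrite //= -/k -/p ?size_rcons ?nth_rcons ?take_k ?ltnS ?le_k ?lt_k -?/u.
  - split; rewrite /= ?(reg_size L) //; try by case: L.
    + by move=> a lt_a; rewrite !ifN ?(heap_input L) //; lia.
    + by move=> v; have lt_v := ltn_ord v; rewrite !ifN ?(heap_est L) //; lia.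
  - apply: bfs_inv_ext push => z [_ [p' range_p' hz]].
    have [eq_p|ne_p] := eqVneq p' p.
      right; have -> : z = w by apply: val_inj; rewrite /= -hz -hw eq_p.
      by rewrite mem_rcons mem_head.
    by left; split=> //; exists p' => //; lia.
  - by rewrite addn1.
  - exact: leqW.
  - move=> a; rewrite ltnS leq_eqVlt nth_rcons => /predU1P[->|lt_a].
      by rewrite eqxx ltnn eqxx.
    by rewrite lt_a !ifN ?qh //; lia.
  - move=> v; have lt_v := ltn_ord v.
    rewrite ifN; last lia.
    rewrite eqn_add2l val_eqE mem_rcons inE.
    have [->|_] /= := eqVneq v w; last exact: dh.
    by rewrite w_dist addn1.
  - by lia.
  - by move=> eq_k; move: lt_k; lia.
  - by rewrite todo_k; move: todo; rewrite /deg; lia.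
(* The list of [u] is exhausted, so the partial scan recorded in the invariant covers all neighbours
   of [u]. *)
have all_nbr z : adj u z -> k < size q /\ exists2 p', off u <= p' < p & h (n + 4 + p') = z.
  by move=> /adj_nbr[p' range_p' hz]; split=> //; exists p' => //; lia.
apply: runs_seq; apply: runs_set; apply: runs_set.
rewrite /upd /= !addn1 (reg_queue L) -/k; split=> //.
exists j.-1; first by move: todo; rewrite /deg; lia.
have Ptr_next : k.+1 < size q ->
    heap s (3 + heap s (est_addr + n + n + k.+1)) = off (nth src q k.+1).
  by move=> lt_k1; rewrite qh // read_off // ltnW.
exists q; split; rewrite //= -/k.
- by split; case: L.
- apply: (bfs_inv_next inv) => // z [lt_k1 [p']]; rewrite Ptr_next //; lia.
- by move=> lt_k1; rewrite Ptr_next // leqnn off_nondecreasing // leqnSn ltn_ord.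
- by move=> eq_k; rewrite /u -eq_k.
- case: ltnP => [lt_k1|_]; rewrite ?Ptr_next ?subnn //; move: todo; rewrite /deg; lia.
Qed.

Lemma runs_bfs_loop j c e q s : bfs_state j c e q s ->
  runs bfs_loop s (fun t s' => t <= (j * 9).+1 /\
    exists j' q', bfs_state j' c e q' s' /\ regs s' Head = size q').
Proof.
move=> st; apply: (@runs_while _ _ 8 (fun j s => exists q, bfs_state j c e q s) j) => /=.
- by move=> j' s' [q' st'] lt_tail; apply: runs_bfs_step st' lt_tail.
- by exists q.
- move=> j' t s' [q' st'] ge_tail le_t; split=> //; exists j', q'; split=> //.
  by apply/eqP; rewrite eqn_leq (bs_head st') -(bs_tail st') leqNgt.
Qed.

Lemma runs_merge_dist j c e q s Q : bfs_state j c e q s -> regs s Head = size q ->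
  (forall t s' (y : 'I_n), t <= 3 * n + 2 -> layout s' c (fun v => maxn (e v) (d src v)) ->
     regs s' Cur = y -> farthest adj src y -> Q t s') ->
  runs merge_dist s Q.
Proof.
move=> st head_q post; have L := bs_layout st.
have all_q := bfs_inv_all adj_conn (bs_inv st) (eq_leq (esym head_q)).
have far := bfs_last_farthest adj_simple adj_conn (bs_inv st) (eq_leq (esym head_q)).
apply: (@runs_fill _ _ (fun v => maxn (heap s (est_addr + v)) (heap s (est_addr + n + v)))) => //.
  move=> v s'; rewrite (reg_size L) (reg_est L) => lt_v s'r s'v s'h /=.
  rewrite s'v !s'r // (reg_est L) (reg_dist L) !s'h; [lia | lia | lia].
move=> t s'; rewrite (reg_size L) (reg_est L) => le_t s'r s'e s'h.
apply: (post t s' _ le_t _ _ far); last by rewrite s'r // (bs_cur st head_q).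
split; rewrite ?s'r //; try by case: L.
- by move=> a lt_a; rewrite s'h ?(heap_input L) //; lia.
- by move=> v; rewrite s'e // (heap_est L) (bs_dist st) all_q.
Qed.

End Source.

(** * Rounds of the sweep and total running time *)

Lemma runs_round c e (src : 'I_n) s Q : layout s c e -> regs s Cur = src ->
  (forall t s' (y : 'I_n), t <= 50 * m.+1 ->
     layout s' c.-1 (fun v => maxn (e v) (d src v)) ->
     regs s' Cur = y -> farthest adj src y -> Q t s') ->
  runs (CSeq (CSetReg Round (ASub (AReg Round) (AConst 1)))
             (CSeq bfs_start (CSeq bfs_loop merge_dist))) s Q.
Proof.
move=> L cur post; apply: runs_seq; apply: runs_set => /=.
apply: runs_seq; apply: (@runs_bfs_start src _ c.-1 e) => //.
  by split; case: L => //= _ _ _ _ -> _ _; rewrite /upd /= subn1.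
move=> t1 s1 le_t1 st1; apply: runs_seq; apply: runs_mono (runs_bfs_loop st1).
move=> t2 s2 [le_t2 [j [q [st2 head_q]]]]; apply: (runs_merge_dist st2 head_q).
move=> t3 s3 y le_t3 L3 cur3 far; apply: post L3 cur3 far.
(* The sum is at most [15 * n + 18 * m + 11], and [n <= m.*2 + 1] makes this at most
   [48 * m + 26]. *)
have := leq_size_edges; move: le_t1 le_t2 le_t3; rewrite -muln2; lia.
Qed.

Lemma runs_sweep s (src : 'I_n) Q :
  layout s (4 * i + 6) (fun=> 0) -> regs s Cur = src ->
  (forall t s' xs c, t <= (4 * i + 6) * (50 * m.+1).+1 + 1 -> sorted (farthest adj) xs ->
     size xs = 4 * i + 6 -> layout s' c (fun v => \max_(x <- xs) d x v) -> Q t s') ->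
  runs sweep s Q.
Proof.
move=> L cur post.
(* [xs] lists the sources already searched from and [u] is the next one; the [u] left at exit is
   dropped. *)
pose I j s' := exists xs (u : 'I_n),
  [/\ layout s' j (fun v => \max_(x <- xs) d x v), regs s' Cur = u,
      sorted (farthest adj) (rcons xs u) & size xs + j = 4 * i + 6].
apply: (@runs_while _ _ (50 * m.+1) I (4 * i + 6)) => [j s1 [xs [u [L1 cur1 far1 size1]]] /=| |].
- rewrite (reg_round L1) => j_gt0; apply: (runs_round L1 cur1).
  move=> t s2 y le_t L2 cur2 far_y; split=> //.
  exists j.-1; first by rewrite prednK.
  exists (rcons xs u), y; split=> //; last by rewrite size_rcons; lia.
    by case: L2 => ? ? ? ? ? ? est2; split=> // v; rewrite est2 big_rcons.
  case: xs far1 {L1 L2 size1} => [|x xs] /= far1; first by rewrite far_y.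
  by rewrite rcons_path last_rcons far1.
- by exists [::], src; split=> //; case: L => ? ? ? ? ? ? est; split=> // v; rewrite est big_nil.
- move=> j t s1 [xs [u [L1 cur1 far1 size1]]] /=; rewrite (reg_round L1) -eqn0Ngt => /eqP j0 le_t.
  move: size1; rewrite j0 addn0 => size1.
  apply: post L1 => //; first by rewrite addn1.
  by case: xs far1 {size1} => //= x xs; rewrite rcons_path => /andP[].
Qed.

End Correctness.

Theorem theorem3 :
  exists (P : cmd) (C : nat),
    forall (n : nat) (adj : rel 'I_n) (i : nat),
      0 < n ->
      simple_graph adj -> connected_graph adj -> alpha_metric adj i ->
      forall h : nat -> nat, encodes_graph adj i h ->
      exists (t : nat) (s' : mstate),
        [/\ exec P (init_state h) t s',
            t <= C * (i.+1 * (num_edges adj).+1) &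
            forall v : 'I_n,
              ecc adj v - (3 * i + 2) <= output s' v /\ output s' v <= ecc adj v].
Proof.
(* Setup and sweep cost at most [6 * m + 14 + (4 * i + 6) * (50 * m + 51)], where
   [4 * i + 6 <= 6 * i.+1]; at [i = m = 0] this equals 320. *)
exists ecc_program, 320 => n adj i n_gt0 adj_simple adj_conn adj_alpha h h_enc.
suff [t [s' [ex [le_t est]]]] : runs ecc_program (init_state h) (fun t s' =>
    t <= 320 * (i.+1 * (num_edges adj).+1) /\ forall v : 'I_n,
      ecc adj v - (3 * i + 2) <= output s' v /\ output s' v <= ecc adj v).
  by exists t, s'.
apply: runs_seq; apply: (runs_setup h_enc) => // t1 s1 le_t1 L1 cur1.
apply: (runs_sweep adj_simple adj_conn h_enc (src := Ordinal n_gt0) L1 cur1).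
move=> t2 s2 xs c le_t2 far_xs size_xs L2; split.
  by have := leq_size_edges adj_simple adj_conn h_enc; nia.
move=> v; rewrite /output (reg_est L2) (heap_est L2); split.
  by have := ecc_sweep adj_simple adj_conn adj_alpha v far_xs size_xs; lia.
apply/bigmax_leqP_seq => x _ _.
by rewrite (dist_sym adj_simple adj_conn) dist_le_ecc.
Qed.
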